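(* Let $P$ be a set of $m$ points in the $(y,z)$-plane, let $t>0$, and let $\mathcal{C}$ be a two-dimensional $t$-shallow cutting of $P$. For any integer $d>0$ there exist a subset $P'\subseteq P$ and a set of two-dimensional rectangles $\mathcal{R}=\{R_1,\dots,R_s\}$ such that: (a) $|P'|=O(m/d)$; (b) every $R_i$ is unbounded along the $z$-axis, i.e. has the form $[y_1,y_2]\times(-\infty,+\infty)$; (c) for every cell $C_i$ of $\mathcal{C}$ there are $g=O(d)$ rectangles $R_{i_1},\dots,R_{i_g}\in\mathcal{R}$ with $list(C_i)\cap(P\setminus P')\subseteq\bigcup_{j=1}^{g}(list(C_i)\cap R_{i_j})$; (d) each rectangle of $\mathcal{R}$ contains $O(t\cdot d)$ points of $P$.
   Context: A two-dimensional $t$-shallow cutting of a set $P$ of $m$ points in the $(y,z)$-plane is a collection of $O(m/t)$ cells, each of the form $[0,a]\times[0,b]$, such that each cell contains at most $2t$ points of $P$ and every point of the plane that dominates at most $t$ points of $P$ lies in some cell. (A point $q$ dominates $p$ if each coordinate of $p$ is at most the corresponding coordinate of $q$.) For a cell $C$, $list(C)=P\cap C$. *)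

(* Defs.v *)
From mathcomp Require Import all_boot all_order all_algebra.
From mathcomp Require Import finmap reals.

Set Implicit Arguments.
Unset Strict Implicit.
Unset Printing Implicit Defensive.

Import Order.TTheory GRing.Theory Num.Theory.
Local Open Scope fset_scope.
Local Open Scope ring_scope.

Definition point (R : realType) := (R * R)%type.

(* (i, j) stands for the axis-parallel rectangle i x j; sides may be unbounded. *)
Definition rectangle (R : realType) := (interval R * interval R)%type.

Definition in_rect (R : realType) (r : rectangle R) (p : point R) : bool :=
  (p.1 \in r.1) && (p.2 \in r.2).

(* P `&` r; for a cell C of a shallow cutting of P, [points_in P C] is list(C). *)
Definition points_in (R : realType) (P : {fset point R}) (r : rectangle R) :
    {fset point R} :=
  [fset p in P | in_rect r p].

Definition dominates (R : realType) (q p : point R) : bool :=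
  (p.1 <= q.1) && (p.2 <= q.2).

(* [0, a] with a in [0, +oo].  The value a = +oo must be allowed: a point with
   one huge coordinate may dominate few points of P, so finitely many bounded
   cells cannot in general cover all points that dominate at most t points. *)
Definition cell_side (R : realType) (i : interval R) : Prop :=
  (exists2 a : R, 0 <= a & i = `[0, a]) \/ i = `[0, +oo[.

Definition is_cell (R : realType) (r : rectangle R) : Prop :=
  cell_side r.1 /\ cell_side r.2.

(* K is the constant hidden in the O(m/t) bound on the number of cells.  As
   cells only contain points with nonnegative coordinates, the points to be
   covered are those of the quadrant [0, +oo[ x [0, +oo[. *)
Definition shallow_cutting (R : realType) (K t : R) (P : {fset point R})
    (C : {fset rectangle R}) : Prop :=
  [/\ #|` C|%:R <= K * (#|` P|%:R / t),
      forall c, c \in C -> is_cell c,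
      forall c, c \in C -> #|` points_in P c|%:R <= 2 * t
    & forall q : point R, 0 <= q.1 -> 0 <= q.2 ->
        #|` [fset p in P | dominates q p]|%:R <= t ->
        exists2 c, c \in C & in_rect c q].

Definition z_unbounded (R : realType) (r : rectangle R) : Prop :=
  exists y1 y2 : R, y1 <= y2 /\ r = (`[y1, y2], `]-oo, +oo[).

(* Main.v *)
Require Import Defs.
From mathcomp Require Import all_boot all_order all_algebra.
From mathcomp Require Import finmap reals.
From mathcomp Require Import zify.

Import Order.TTheory GRing.Theory Num.Theory.
Local Open Scope fset_scope.
Local Open Scope ring_scope.

(* Cut the plane into vertical slabs of w ~ 2td points of P each.  The cells are
   nested inside a slab that they span horizontally, so together those cells
   contain at most 2t points of the slab; discarding these in all slabs costs
   O(m/(td)) * O(t) = O(m/d) points.  After that a cell retains points only in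
   the single slab containing its right side, and in the leftmost slab, from
   which nothing is discarded so that the bound also holds when m < td.  Thus
   two rectangles per cell suffice.  Points sharing a y-coordinate may prevent
   slabs of the right size: a vertical line crossing a multiple of w in the
   counting order is made a slab of its own.  It is always spanned, hence needs
   no rectangle. *)

Lemma fset_argmax {T : choiceType} {R : realType} (f : T -> R) (X : {fset T}) x0 :
  x0 \in X -> exists2 x, x \in X & forall y, y \in X -> f y <= f x.
Proof.
move=> x0X.
case: (@Order.TotalTheory.arg_maxP _ R X [` x0X] predT (fun i => f (val i))) => //.
move=> i _ imax; exists (val i); first exact: valP.
by move=> y yX; exact: (imax [` yX]).
Qed.

Lemma leq_card_fibers {T : choiceType} (X : {fset T}) (f : T -> nat) (B M : nat) :
  (forall x, x \in X -> (f x < B)%N) ->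
  (forall k, #|` [fset x in X | f x == k]| <= M)%N ->
  (#|` X| <= B * M)%N.
Proof.
move=> fB fM; rewrite -sum1_size.
case: B fB => [|B] fB.
  by rewrite big_seq_cond big1// => x /andP[/fB].
rewrite big_seq (partition_big (fun x => inord (f x) : 'I_B.+1) xpredT)//=.
rewrite -[X in (_ <= X * _)%N]card_ord -sum_nat_const; apply: leq_sum => k _.
apply: leq_trans (fM k); rewrite -big_seq_cond sum1_count -size_filter.
apply: uniq_leq_size; first by rewrite filter_uniq ?fset_uniq.
move=> x; rewrite mem_filter => /andP[/eqP <- xX].
by rewrite !inE/= xX inordK ?fB /=.
Qed.

Lemma cell_side_ge0 {R : realType} {i : interval R} {x} :
  cell_side i -> x \in i -> 0 <= x.
Proof. by case=> [[a _ ->]|->]; rewrite in_itv/= ?andbT // => /andP[]. Qed.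

Lemma cell_side_down {R : realType} {i : interval R} {x y} :
  cell_side i -> y \in i -> 0 <= x -> x <= y -> x \in i.
Proof.
case=> [[a _ ->]|->]; rewrite !in_itv/= => /andP[y0 ya] x0 xy; rewrite x0//=.
exact: le_trans ya.
Qed.

Section Slabs.
Context {R : realType} (P : {fset point R}) (w : nat).

Definition count_lt (y : R) := #|` [fset p in P | p.1 < y]|.
Definition count_le (y : R) := #|` [fset p in P | p.1 <= y]|.

(* Ranking P by first coordinate, a vertical line whose ranks stay between two
   consecutive multiples j * w and (j + 1) * w gets the index 2 * j; a line
   whose ranks cross a multiple of w gets an index no other line has. *)
Definition slab (y : R) := (count_lt y %/ w + count_le y %/ w)%N.

Lemma count_lt_le y : (count_lt y <= count_le y)%N.
Proof.
apply: fsubset_leq_card; apply/fsubsetP => p; rewrite !inE/=.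
by case/andP=> -> /ltW.
Qed.

Lemma count_le_lt y y' : y < y' -> (count_le y <= count_lt y')%N.
Proof.
move=> yy'; apply: fsubset_leq_card; apply/fsubsetP => p; rewrite !inE/=.
by case/andP=> -> /le_lt_trans ->.
Qed.

Lemma count_le_card y : (count_le y <= #|` P|)%N.
Proof. by apply: fsubset_leq_card; apply/fsubsetP => p; rewrite !inE/= => /andP[]. Qed.

Lemma slab_mono y y' : y <= y' -> (slab y <= slab y')%N.
Proof.
rewrite le_eqVlt => /predU1P[->//|yy'].
have := count_le_lt _ _ yy'; have := count_lt_le y; have := count_lt_le y'.
move=> /(leq_div2r w) h1 /(leq_div2r w) h2 /(leq_div2r w) h3; rewrite /slab; lia.
Qed.

Definition off_grid (y : R) := (count_le y %/ w == count_lt y %/ w)%N.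

(** The ranks [count_lt y], [count_le y], [count_lt y'], [count_le y'] increase weakly, and so do
    their quotients by [w]; equal sums of the first two and the last two force all four to agree. *)
Lemma slab_off_grid y y' : y < y' -> slab y = slab y' -> off_grid y && off_grid y'.
Proof.
move=> yy'; have := count_le_lt _ _ yy'.
have := count_lt_le y; have := count_lt_le y'.
move=> /(leq_div2r w) h1 /(leq_div2r w) h2 /(leq_div2r w) h3.
rewrite /slab /off_grid => e; apply/andP; split; apply/eqP; lia.
Qed.

Lemma slab_all_off_grid y y' x :
  y < y' -> slab y = slab y' -> slab x = slab y -> off_grid x.
Proof.
move=> yy' e ex; have /andP[gy _] := slab_off_grid _ _ yy' e.
case: (ltgtP x y) => [/slab_off_grid/(_ ex)|/slab_off_grid/(_ (esym ex))|->//];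
  by case/andP.
Qed.

(** Off the grid an index is twice a quotient, so both ranks have the same quotient by [w]. *)
Lemma off_grid_small y y' : (0 < w)%N -> off_grid y -> off_grid y' ->
  slab y = slab y' -> (count_le y' <= count_lt y + w)%N.
Proof.
rewrite /slab => w0 /eqP gy /eqP gy' e.
have e' : (count_le y' %/ w = count_lt y %/ w)%N by lia.
rewrite (divn_eq (count_le y') w) (divn_eq (count_lt y) w) e'.
have := ltn_pmod (count_le y') w0; lia.
Qed.

Definition strip (y1 y2 : R) : rectangle R := (`[y1, y2], `]-oo, +oo[).

Lemma in_strip y1 y2 p : in_rect (strip y1 y2) p = (y1 <= p.1 <= y2).
Proof. by rewrite /in_rect/= !in_itv/= andbT. Qed.

Lemma card_strip y1 y2 : y1 <= y2 ->
  (#|` points_in P (strip y1 y2)| + count_lt y1 = count_le y2)%N.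
Proof.
move=> y12.
have -> : points_in P (strip y1 y2) =
    [fset p in P | p.1 <= y2] `\` [fset p in P | p.1 < y1].
  apply/fsetP => p; rewrite !inE/= in_strip.
  by case: (p \in P) => //=; rewrite -leNgt.
have sub : [fset p in P | p.1 < y1] `<=` [fset p in P | p.1 <= y2].
  apply/fsubsetP => p; rewrite !inE/= => /andP[-> /ltW h]; exact: le_trans y12.
rewrite cardfsD (fsetIidPr sub) subnK//; exact: fsubset_leq_card.
Qed.

(** All candidate rectangles at once: shape and size bound hold by construction, and each cell only
    has to pick its members. *)
Definition strips : {fset rectangle R} :=
  [fset strip p.1 q.1 | p in P, q in [fset q in P | (p.1 <= q.1) &&
    (#|` points_in P (strip p.1 q.1)| <= w)%N]].

Lemma stripsP r : r \in strips ->
  z_unbounded r /\ (#|` points_in P r| <= w)%N.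
Proof.
case/imfset2P => p /= _ [q /=]; rewrite !inE/= => /and3P[_ pq h] ->.
by split=> //; exists p.1, q.1.
Qed.

Definition slab_cover k (G : {fset rectangle R}) :=
  [/\ G `<=` strips, (#|` G| <= 1)%N
    & forall p, p \in P -> slab p.1 = k -> exists2 r, r \in G & in_rect r p].

(** The strip from the leftmost to the rightmost point of the slab works, by [off_grid_small]. *)
Lemma slab_coverP k : (0 < w)%N ->
  (forall p, p \in P -> slab p.1 = k -> off_grid p.1) ->
  exists G, slab_cover k G.
Proof.
move=> w0 flat.
have [e|[x0 x0X]] := fset_0Vmem [fset p in P | slab p.1 == k].
  exists fset0; split; rewrite ?fsub0set ?cardfs0// => p pP pk.
  by have : p \in fset0 by rewrite -e !inE/= pP pk/=.
have [p + pmin] := @fset_argmax _ R (fun p => - p.1) _ _ x0X.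
have [q + qmax] := @fset_argmax _ R (fun p => p.1) _ _ x0X.
rewrite !inE/= => /andP[qP /eqP qk] /andP[pP /eqP pk].
have in_pq x : x \in P -> slab x.1 = k -> p.1 <= x.1 <= q.1.
  move=> xP xk; have xX : x \in [fset p in P | slab p.1 == k].
    by rewrite !inE/= xP xk/=.
  by rewrite -lerN2 pmin ?qmax.
have pq : p.1 <= q.1 by have /andP[] := in_pq p pP pk.
exists [fset strip p.1 q.1]; split; last 1 first.
- move=> x xP xk; exists (strip p.1 q.1); first by rewrite inE.
  by rewrite in_strip in_pq.
- rewrite fsub1set; apply/imfset2P; exists p => //; exists q => //.
  rewrite !inE/= qP pq/=.
  rewrite -(leq_add2r (count_lt p.1)) card_strip// addnC.
  by apply: off_grid_small; rewrite ?flat ?pk ?qk.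
- by rewrite cardfs1.
Qed.

End Slabs.

Section Cells.
Context {R : realType} (P : {fset point R}) (C : {fset rectangle R}) (T d : nat).
Context (T0 : (0 < T)%N).
Context (d0 : (0 < d)%N).
Context (cellC : forall c, c \in C -> is_cell c).
Context (cardC : forall c, c \in C -> (#|` points_in P c| <= T)%N).

Let w := (T * d)%N.
Let w0 : (0 < w)%N. Proof. by rewrite muln_gt0 T0. Qed.
Let sl (p : point R) := slab P w p.1.

(** Points to the left of [p] are not tested: if a cell [c] contains [p], those with nonnegative
    abscissa lie in [c.1] anyway, and the others lie in no cell. *)
Definition spans (c : rectangle R) (p : point R) :=
  all (fun q : point R => (sl q == sl p) && (p.1 <= q.1) ==> (q.1 \in c.1)) P.

Definition exceptional : {fset point R} :=
  [fset p in P | (0 < sl p)%N &&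
    has (fun c => in_rect c p && spans c p) C].

Lemma exceptionalP p : p \in exceptional ->
  [/\ p \in P, (0 < sl p)%N & exists c, [/\ c \in C, in_rect c p & spans c p]].
Proof.
rewrite !inE/= => /and3P[pP p0 /hasP[c cC /andP[cp cs]]].
by split=> //; exists c.
Qed.

(* The cell witnessing the topmost exceptional point of a slab contains all of
   them. *)
Lemma card_exceptional_slab k :
  (#|` [fset p in exceptional | sl p == k]| <= T)%N.
Proof.
have [->|[x0 x0X]] := fset_0Vmem [fset p in exceptional | sl p == k].
  by rewrite cardfs0.
have [p + pmax] := @fset_argmax _ R (fun p => p.2) _ _ x0X.
rewrite in_fset/= inE/= => /andP[].
move=> /exceptionalP[pP _ [c [cC /andP[cp1 cp2] /allP cs]]] /eqP pk.
apply: leq_trans (cardC _ cC); apply: fsubset_leq_card; apply/fsubsetP => q qX.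
have := qX; rewrite in_fset /= inE/= => /andP[].
move=> /exceptionalP[qP _ [c' [c'C /andP[c'q1 c'q2] _]]] /eqP qk.
have [s1 s2] := cellC _ cC; have [s1' s2'] := cellC _ c'C.
have q10 := cell_side_ge0 s1' c'q1; have q20 := cell_side_ge0 s2' c'q2.
rewrite !inE/= qP/= /in_rect; apply/andP; split; last first.
  exact: cell_side_down s2 cp2 q20 (pmax _ qX).
have [pq|/ltW qp] := leP p.1 q.1; last exact: cell_side_down s1 cp1 q10 qp.
by have := cs q qP; rewrite qk pk eqxx pq.
Qed.

Lemma card_exceptional : (#|` exceptional| * d <= 2 * #|` P|)%N.
Proof.
have h : (#|` exceptional| <= (2 * (#|` P| %/ w)) * T)%N.
  (* Indices here run from 1 to twice the quotient of the size of [P] by [w]. Shifting them down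
     avoids an extra fibre, which would break the bound when [P] is small. *)
  apply: (leq_card_fibers _ (fun p => (sl p).-1)) => [p|k].
    case/exceptionalP => _ + _; rewrite /sl /slab.
    have /(leq_div2r w) := count_lt_le P p.1.
    have /(leq_div2r w) := count_le_card P p.1; lia.
  apply: leq_trans (card_exceptional_slab k.+1); apply: fsubset_leq_card.
  apply/fsubsetP => p; rewrite in_fset/= inE/= => /andP[pX].
  have [_ p0 _] := exceptionalP _ pX.
  by rewrite in_fset/= inE/= pX /= -eqSS prednK.
have := leq_trunc_div #|` P| w; rewrite {2}/w; nia.
Qed.

Lemma slab0_cover : exists G, slab_cover P w 0 G.
Proof.
apply: slab_coverP => // p _ /eqP.
by rewrite /slab /off_grid addn_eq0 => /andP[/eqP-> /eqP->].
Qed.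

(** A point of [c] that [c] does not span has a point of its slab to its right, outside [c.1], so
    the right side of [c] falls in that slab. This determines the slab, and its two distinct lines
    keep it off the grid. *)
Lemma cut_slab_cover c : c \in C -> exists2 G, G `<=` strips P w & (#|` G| <= 1)%N /\
  forall p, p \in P -> in_rect c p -> ~~ spans c p ->
    exists2 r, r \in G & in_rect r p.
Proof.
move=> cC; have [s1 s2] := cellC _ cC.
have [/hasP[p pP /andP[/andP[cp1 cp2] np]]|/hasPn none] :=
  boolP (has (fun p => in_rect c p && ~~ spans c p) P); last first.
  exists fset0; rewrite ?fsub0set ?cardfs0//; split=> // p pP cp np.
  by have := none p pP; rewrite cp np.
have nspan x : x \in P -> in_rect c x -> ~~ spans c x ->
    exists q, [/\ q \in P, sl q = sl x, x.1 < q.1 & q.1 \notin c.1].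
  move=> xP /andP[cx _] /allPn[q qP]; rewrite negb_imply.
  case/andP=> /andP[/eqP e xq] nq; exists q; split=> //.
  by rewrite lt_neqAle xq andbT; apply: contraNneq nq => <-.
(* The point [q] escaping from [c.1] lies to the right of every [y] in [c], since [c.1] is closed
   downwards. *)
have same x y : x \in P -> in_rect c x -> ~~ spans c x -> in_rect c y ->
    (sl y <= sl x)%N.
  move=> xP cx nx /andP[cy _]; have [q [qP <- xq nq]] := nspan x xP cx nx.
  apply: slab_mono; rewrite leNgt; apply: contra nq => /ltW qy.
  apply: (cell_side_down s1 cy _ qy); apply: le_trans _ (ltW xq).
  by case/andP: cx => cx _; exact: (cell_side_ge0 s1 cx).
have cp : in_rect c p by rewrite /in_rect cp1.
have [q [qP qp pq nq]] := nspan p pP cp np.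
have [x _ xk|G [G1 G2 G3]] := slab_coverP P w (sl p) w0.
  exact: slab_all_off_grid pq (esym qp) xk.
exists G => //; split=> // x xP cx nx; apply: G3 => //; apply/eqP.
by rewrite eqn_leq; apply/andP; split; apply: same.
Qed.

End Cells.

Theorem theorem6 (R : realType) (K : R) :
  exists ca cc cd : R,
  forall (P : {fset point R}) (t : R) (C : {fset rectangle R}) (d : nat),
    0 < t -> shallow_cutting K t P C -> (0 < d)%N ->
  exists (P' : {fset point R}) (Rs : {fset rectangle R}),
    P' `<=` P /\
    [/\ #|` P'|%:R <= ca * (#|` P|%:R / d%:R),
        forall r, r \in Rs -> z_unbounded r,
        forall c, c \in C ->
          exists G : {fset rectangle R},
            [/\ G `<=` Rs,
                #|` G|%:R <= cc * d%:R
              & points_in P c `&` (P `\` P') `<=`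
                  \bigcup_(r <- G) points_in (points_in P c) r]
      & forall r, r \in Rs -> #|` points_in P r|%:R <= cd * (t * d%:R)].
Proof.
(* The first 2 is that of [card_exceptional], the second counts the strips per cell, the third comes
   from [T <= 2 * t]. *)
exists 2, 2, 2 => P t C d t0 [_ cellC cardC _] d0.
have dR : 0 < d%:R :> R by rewrite ltr0n.
have t2 : 0 <= 2 * t by rewrite mulr_ge0 ?ltW.
pose T := Num.truncn (2 * t).
have cardT c : c \in C -> (#|` points_in P c| <= T)%N.
  by move=> cC; rewrite truncn_ge_nat// cardC.
(* If [T = 0] the slab size [T * d] degenerates, but then no cell contains a point of [P]. *)
have [T0|T0] := posnP T.
  exists fset0, fset0; split; first exact: fsub0set.
  split=> [||c cC|] //; first by rewrite cardfs0 mulr_ge0// divr_ge0.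
  exists fset0; split; [exact: fsub0set|by rewrite cardfs0 mulr_ge0|].
  have := cardT c cC; rewrite T0 leqn0 => /eqP/cardfs0_eq ->.
  by rewrite fset0I fsub0set.
exists (exceptional P C T d), (strips P (T * d)); split.
  by apply/fsubsetP => p /exceptionalP[].
split.
- rewrite mulrA ler_pdivlMr// -!natrM ler_nat.
  exact: card_exceptional.
- by move=> r /stripsP[].
- move=> c cC.
  have [G0 [G0s G01 G0P]] := slab0_cover P T d T0 d0.
  have [G1 G1s [G11 G1P]] := cut_slab_cover P C T d T0 d0 cellC c cC.
  exists (G0 `|` G1); split.
  + by rewrite fsubUset G0s.
  + rewrite -natrM ler_nat.
    have : (#|` G0 `|` G1| <= #|` G0| + #|` G1|)%N by rewrite cardfsU leq_subr.
    lia.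
  + apply/fsubsetP => p; rewrite in_fsetI in_fsetD => /and3P[pPc pX pP].
    have cp : in_rect c p by move: pPc; rewrite !inE/= => /andP[].
    have [r rG rp] : exists2 r, r \in G0 `|` G1 & in_rect r p.
      (* In the leftmost slab [G0] covers [p]; elsewhere [p] is spanned, hence exceptional against
         [pX], or covered by [G1]. *)
      have [p0|p0] := posnP (slab P (T * d) p.1).
        by have [r rG rp] := G0P p pP p0; exists r; rewrite // inE rG.
      have [cs|ncs] := boolP (spans P T d c p).
        case/negP: pX; rewrite !inE/= pP p0/=; apply/hasP; exists c => //.
        by rewrite cp.
      by have [r rG rp] := G1P p pP cp ncs; exists r; rewrite // inE rG orbT.
    by apply/bigfcupP; exists r; rewrite ?rG// !inE/= pP cp.
- move=> r /stripsP[_ rw]; rewrite mulrA.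
  apply: le_trans (_ : (T * d)%:R <= _); first by rewrite ler_nat.
  by rewrite natrM ler_wpM2r// truncn_le.
Qed.
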